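(* There exist absolute constants $c,C>0$ such that for any (possibly randomized) algorithm $\mathcal{A}$ interacting with a local oracle, and any $T\in\mathbb{N}$, $d\geq 2$, there is a function $f:\mathbb{R}^d\to\mathbb{R}$ such that: 1. $f$ is $C$-Lipschitz, $f(\mathbf{0})-\inf_{\mathbf{x}}f(\mathbf{x})\leq C$, and $\inf\{\|\mathbf{x}\| : \partial f(\mathbf{x})=\{\mathbf{0}\}\}\leq C$. 2. With probability at least $1-CT\exp(-cd)$ over the algorithm's randomness, the iterates $\mathbf{x}_1,\ldots,\mathbf{x}_T$ produced by the algorithm (when run on $f$) satisfy $$\inf_{\mathbf{x}\in\Sigma}\ \min_{t\in\{1,\dots,T\}}\|\mathbf{x}_t-\mathbf{x}\|\geq c,$$ where $\Sigma$ is the set of $c$-stationary points of $f$.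
   Context: $\|\cdot\|$ is the Euclidean norm. Local oracle: an oracle $\mathbb{O}$ assigns to every function $f$ and point $\mathbf{x}$ a quantity $\mathbb{O}_f(\mathbf{x})$. It is local if for any $\mathbf{x}$ and any two functions $f,g$ that are equal over some neighborhood of $\mathbf{x}$, $\mathbb{O}_f(\mathbf{x})=\mathbb{O}_g(\mathbf{x})$. Algorithm interacting with a local oracle: it produces $\mathbf{x}_1$, possibly at random, receives $\mathbb{O}_f(\mathbf{x}_1)$ for some local oracle $\mathbb{O}$, and for every $t>1$ produces $\mathbf{x}_t$, possibly at random, based on the previously observed responses. Deterministic algorithms are a special case. Generalized gradient: for Lipschitz $f:\mathbb{R}^d\to\mathbb{R}$, $\partial f(\mathbf{x}):=\mathrm{conv}\{\mathbf{u}:\mathbf{u}=\lim_{k\to\infty}\nabla f(\mathbf{x}_k),\ \mathbf{x}_k\to\mathbf{x}\}$, over sequences of differentiability points $\mathbf{x}_k$ of $f$ (the Clarke generalized gradient set). A point $\mathbf{x}$ is an $\epsilon$-stationary point of $f$ if there is $\mathbf{u}\in\partial f(\mathbf{x})$ with $\|\mathbf{u}\|\leq\epsilon$. *)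

(* Defs.v *)
(* MathComp-Analysis: R^d is the type of row vectors 'rV[R]_d, for R : realType. *)
From HB Require Import structures.
From mathcomp Require Import all_boot all_order all_algebra.
From mathcomp Require Import all_classical all_reals all_analysis.
Set Implicit Arguments.
Unset Strict Implicit.
Unset Printing Implicit Defensive.

Import Order.TTheory GRing.Theory Num.Theory.
Import numFieldNormedType.Exports.
Local Open Scope classical_set_scope.
Local Open Scope ring_scope.

Section Euclidean.
Context {R : realType} {d : nat}.
Implicit Types (f : 'rV[R]_d -> R) (x : 'rV[R]_d).

(* The library norm on 'rV[R]_d is the sup norm: it induces the same topology
   and the same notion of differentiability, but all the quantitative bounds
   are stated with the Euclidean norm below. *)
Definition l2norm x : R := Num.sqrt (\sum_i x ord0 i ^+ 2).

Definition l2_lipschitz (k : R) f : Prop :=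
  forall x y, `|f x - f y| <= k * l2norm (x - y).

Definition grad f x : 'rV[R]_d := \row_i 'D_(delta_mx ord0 i) f x.

Definition convex_hull (A : set 'rV[R]_d) : set 'rV[R]_d :=
  [set u | exists (n : nat) (a : 'I_n -> R) (v : 'I_n -> 'rV[R]_d),
    [/\ forall i, 0 <= a i, \sum_i a i = 1, forall i, A (v i)
      & u = \sum_i a i *: v i]].

Definition limiting_gradients f x : set 'rV[R]_d :=
  [set u | exists y : nat -> 'rV[R]_d,
    [/\ forall k, differentiable f (y k), y @ \oo --> x
      & (fun k => grad f (y k)) @ \oo --> u]].

(* Clarke generalized gradient; meaningful for Lipschitz f. *)
Definition clarke f x : set 'rV[R]_d := convex_hull (limiting_gradients f x).

Definition stationary (e : R) f : set 'rV[R]_d :=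
  [set x | exists2 u, clarke f x u & l2norm u <= e].

End Euclidean.

Section Interaction.
Context {R : realType} {d : nat} {Z : Type}.

Definition oracle : Type := ('rV[R]_d -> R) -> 'rV[R]_d -> Z.

Definition local_oracle (O : oracle) : Prop :=
  forall (f g : 'rV[R]_d -> R) (x : 'rV[R]_d),
    (\forall y \near x, f y = g y) -> O f x = O g x.

(* A deterministic algorithm maps the list of the responses observed so far,
   oldest first, to its next query. *)
Fixpoint responses (a : seq Z -> 'rV[R]_d) (o : 'rV[R]_d -> Z) (t : nat) :
    seq Z :=
  if t is s.+1 then rcons (responses a o s) (o (a (responses a o s))) else [::].

(* Numbered from 0: this is the (t+1)-st query. *)
Definition iterate (a : seq Z -> 'rV[R]_d) (o : 'rV[R]_d -> Z) (t : nat) :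
    'rV[R]_d :=
  a (responses a o t).

End Interaction.
Arguments oracle : clear implicits.

(* A randomized algorithm draws w in a probability space, once and for all (w
   may encode arbitrarily many independent draws), and then proceeds as the
   deterministic algorithm A w. *)
Definition random_algorithm (R : realType) (d : nat) (Z Omega : Type) : Type :=
  Omega -> seq Z -> 'rV[R]_d.

(* The iterates are random variables, for the Borel sigma-algebra of R^d, when
   A is run on a Lipschitz function. This is only the well-posedness of
   "probability over the randomness of the algorithm"; it holds for every
   deterministic algorithm. *)
Definition iterates_measurable (R : realType) (d : nat) (Z : Type)
    (disp : measure_display) (Omega : measurableType disp)
    (A : random_algorithm R d Z Omega) (O : oracle R d Z) : Prop :=
  forall (k : R) (f : 'rV[R]_d -> R), l2_lipschitz k f -> forall t : nat,
    measurable_fun [set: Omega]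
      ((fun w => iterate (A w) (O f) t)
         : Omega -> g_sigma_algebraType (@open 'rV[R]_d)).

(* Main.v *)
Require Import Defs.
From HB Require Import structures.
From mathcomp Require Import all_boot all_order all_algebra.
From mathcomp Require Import all_classical all_reals all_analysis.
From mathcomp Require Import measurable_realfun.
From mathcomp Require Import ring lra zify.
Set Implicit Arguments.
Unset Strict Implicit.
Unset Printing Implicit Defensive.
Import Order.TTheory GRing.Theory Num.Theory.
Import numFieldNormedType.Exports.
Local Open Scope classical_set_scope.
Local Open Scope ring_scope.

(** The hard functions form a finite family indexed by a word s of length T over
    K = 2 ^ d letters and a sign vector w. Put |x'| for the Euclidean norm of x
    with its coordinate i0 erased. The starting point is the function
    base s x = valley s x_i0 + |x'|, where valley s is a nonnegative function of
    one variable, Lipschitz with constant 1, descending towards its only minimum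
    bottom s with slope at least 1/2 on both sides. Its only stationary point is
    bottom s on the axis i0, and a channel issuing from there removes it: along
    the direction sgnvec w the landscape falls below -1 at constant distance, and
    truncation at -1 creates the stationary points of hard s w.

    Every point above level -1 has a direction along which hard s w increases at
    rate 1/2 on a whole neighbourhood (landscape_uphill), which bounds all
    limiting gradients away from 0 (uphill_not_stationary). Hence hard s w = -1
    at stationary points (stationary_hard). Since base is nonnegative and hard is
    Lipschitz, a query that misses the channel is at constant distance from all
    stationary points (lucky_far).

    The channel is contained in the union of a very thin slab, where x_i0 is at
    distance at most rad ^ T from bottom s, and of a cone of constant aperture
    around the direction sgnvec w. Both are hidden from the algorithm.
    - The slab. The wells of the prefixes of s are nested intervals
      that shrink towards bottom s, and outside the well of a prefix u the
      function valley s depends on u only (valley_prefix). If every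
      earlier query has avoided the well of as many letters as its rank, then
      the t-th query is chosen from the knowledge of t - 1 letters, and it falls
      into the well of one t-th letter at most, among K (card_first_well).
    - The cone. Two sign vectors whose cones contain a common point disagree on
      at most an eighth of the coordinates, so a given point lies in the cones of
      an exponentially small fraction of the sign vectors (card_cone).
    Consequently, whatever the random seed, all but a fraction of order
    T * (15/16) ^ d of the family is lucky for all T queries (card_unlucky).
    Averaging over the seed yields one member of the family for which the
    probability of being unlucky is at most that fraction (exists_unlikely). *)

(** * The Euclidean norm *)

Section EuclideanSpace.
Context {R : realType} {d : nat}.
Implicit Types (u v x y : 'rV[R]_d) (f : 'rV[R]_d -> R).

Definition dot u v : R := \sum_i u ord0 i * v ord0 i.

Lemma dotC u v : dot u v = dot v u.
Proof. by apply: eq_bigr => i _; rewrite mulrC. Qed.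

Lemma dotDl u v x : dot (u + v) x = dot u x + dot v x.
Proof. by rewrite -big_split; apply: eq_bigr => i _; rewrite mxE mulrDl. Qed.

Lemma dotZl a u v : dot (a *: u) v = a * dot u v.
Proof. by rewrite mulr_sumr; apply: eq_bigr => i _; rewrite mxE mulrA. Qed.

Lemma dotDr u v x : dot x (u + v) = dot x u + dot x v.
Proof. by rewrite dotC dotDl !(dotC x). Qed.

Lemma dotZr a u v : dot v (a *: u) = a * dot v u.
Proof. by rewrite dotC dotZl dotC. Qed.

Lemma dotNr u v : dot v (- u) = - dot v u.
Proof. by rewrite -scaleN1r dotZr mulN1r. Qed.

Lemma dot_sum n (a : 'I_n -> R) (u : 'I_n -> 'rV[R]_d) v :
  dot (\sum_i a i *: u i) v = \sum_i a i * dot (u i) v.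
Proof.
under [RHS]eq_bigr => i _ do rewrite mulr_sumr.
rewrite exchange_big; apply: eq_bigr => j _; rewrite summxE mulr_suml.
by apply: eq_bigr => i _; rewrite mxE mulrA.
Qed.

Lemma dot_ge0 u : 0 <= dot u u.
Proof. by apply: sumr_ge0 => i _; rewrite -expr2 sqr_ge0. Qed.

Lemma l2normE u : l2norm u = Num.sqrt (dot u u).
Proof. by rewrite /l2norm; congr Num.sqrt; apply: eq_bigr => i _;
  rewrite expr2. Qed.

Lemma l2norm_ge0 u : 0 <= l2norm u.
Proof. exact: sqrtr_ge0. Qed.

Lemma l2norm_sqr u : l2norm u ^+ 2 = dot u u.
Proof. by rewrite l2normE sqr_sqrtr// dot_ge0. Qed.

Lemma l2norm0 : l2norm (0 : 'rV[R]_d) = 0.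
Proof.
by rewrite /l2norm big1 ?sqrtr0// => i _; rewrite mxE expr0n.
Qed.

Lemma l2norm_eq0 u : l2norm u = 0 -> u = 0.
Proof.
move=> u0; have: dot u u = 0 by rewrite -l2norm_sqr u0 expr0n.
move/eqP; rewrite psumr_eq0 => [/allP u0i|i _]; last by rewrite -expr2 sqr_ge0.
apply/rowP => i; rewrite mxE; apply/eqP.
by have := u0i i (mem_index_enum i); rewrite /= mulf_eq0 orbb.
Qed.

Lemma l2normZ a u : l2norm (a *: u) = `|a| * l2norm u.
Proof.
by rewrite !l2normE dotZl dotZr mulrA -expr2 sqrtrM ?sqr_ge0// sqrtr_sqr.
Qed.

Lemma l2normN u : l2norm (- u) = l2norm u.
Proof. by rewrite -scaleN1r l2normZ normrN1 mul1r. Qed.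

Lemma l2normB u v : l2norm (u - v) = l2norm (v - u).
Proof. by rewrite -l2normN opprB. Qed.

Lemma dot_le u v : dot u v <= l2norm u * l2norm v.
Proof.
have [/l2norm_eq0 ->|/eqP u0] := eqVneq (l2norm u) 0.
  by rewrite l2norm0 mul0r /dot big1// => i _; rewrite mxE mul0r.
have [/l2norm_eq0 ->|/eqP v0] := eqVneq (l2norm v) 0.
  by rewrite l2norm0 mulr0 /dot big1// => i _; rewrite mxE mulr0.
have up : 0 < l2norm u by rewrite lt_neqAle l2norm_ge0 andbT eq_sym; exact/eqP.
have vp : 0 < l2norm v by rewrite lt_neqAle l2norm_ge0 andbT eq_sym; exact/eqP.
have := dot_ge0 (l2norm v *: u + (- l2norm u) *: v).
rewrite !(dotDl, dotDr, dotZl, dotZr) (dotC v u) -!l2norm_sqr => h.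
have : 0 < l2norm u * l2norm v by exact: mulr_gt0.
move: h; set a := l2norm u; set b := l2norm v; set t := dot u v => h ab.
have : 0 <= (a * b) * (a * b - t) by lra.
by rewrite pmulr_rge0// subr_ge0.
Qed.

Lemma l2normD u v : l2norm (u + v) <= l2norm u + l2norm v.
Proof.
rewrite -(ler_pXn2r (isT : (0 < 2)%N)) ?nnegrE ?addr_ge0 ?l2norm_ge0//.
rewrite sqrrD !l2norm_sqr !(dotDl, dotDr) (dotC v u).
have := dot_le u v; lra.
Qed.

Lemma coord_le u i : `|u ord0 i| <= l2norm u.
Proof.
rewrite -(ler_pXn2r (isT : (0 < 2)%N)) ?nnegrE ?l2norm_ge0//.
rewrite real_normK ?num_real// l2norm_sqr /dot (bigD1 i)//= -expr2.
by rewrite lerDl sumr_ge0// => j _; rewrite -expr2 sqr_ge0.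
Qed.

Lemma cvg_coord x i : (fun y : 'rV[R]_d => y ord0 i) @ x --> x ord0 i.
Proof. exact: (@coord_continuous R 1 d). Qed.

Lemma l2norm_continuous : continuous (@l2norm R d).
Proof.
move=> x; apply: (@continuous_comp _ _ _ (fun y => \sum_i y ord0 i ^+ 2)
  Num.sqrt).
  apply: continuous_big => [|i _ {}x]; first exact: add_continuous.
  under eq_fun do rewrite expr2.
  by apply: (cvgM (@cvg_coord x i) (@cvg_coord x i)).
exact: sqrt_continuous.
Qed.

Lemma l2dist_continuous x : continuous (fun y => l2norm (y - x)).
Proof.
move=> y; apply: (cvg_comp (fun y => y - x) (@l2norm R d)).
  exact: (cvgB cvg_id (cvg_cst x)).
exact: l2norm_continuous.
Qed.

Lemma dot_continuousl v : continuous (fun u => dot u v).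
Proof.
apply: continuous_big => [|i _ x]; first exact: add_continuous.
exact: (cvgM (@cvg_coord x i) (@cvg_cst _ _ _ _ _)).
Qed.

Lemma near_l2ball x r : 0 < r -> \forall y \near x, l2norm (y - x) < r.
Proof.
move=> r0; have := @l2dist_continuous x x.
by rewrite /continuous_at subrr l2norm0 => /cvgr_lt; exact.
Qed.

End EuclideanSpace.

(** * Non-stationarity from uniform ascent *)

Lemma near_cst_differentiable (R : numFieldType) (V W : normedModType R)
    (f : V -> W) (x : V) (k : W) : (\forall y \near x, f y = k) ->
  differentiable f x.
Proof.
move=> fk; have fxk : f x = k by exact: nbhs_singleton fk.
have c0 : continuous (\0 : V -> W) by exact: cst_continuous.
have e0 : f \o shift x = cst (f x) + \0 +o_ 0 id.
  apply/eqaddoP => _/posnumP[e].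
  have : \forall h \near (0 : V), f (h + x) = k.
    by move: fk; rewrite (near_shift 0 x) subr0.
  apply: filterS => h hk.
  rewrite [X in `|X|](_ : _ = 0) ?normr0 ?mulr_ge0//.
  by rewrite !fctE /= hk fxk addr0 subrr.
apply/diff_locallyP; rewrite (diff_unique c0 e0).
by split => //.
Qed.

Section Stationarity.
Context {R : realType} {d : nat}.
Implicit Types (u v x y : 'rV[R]_d) (f g : 'rV[R]_d -> R).

Lemma convex_hull_dot_ge (A : set 'rV[R]_d) v (e : R) u :
  (forall z, A z -> e <= dot z v) -> convex_hull A u -> e <= dot u v.
Proof.
move=> Ae [n [a [z [a0 a1 Az ->]]]]; rewrite dot_sum.
rewrite -[e]mul1r -a1 mulr_suml; apply: ler_sum => i _.
by rewrite ler_wpM2l// Ae.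
Qed.

Lemma differentiable_derive_dot f x v : differentiable f x ->
  'D_v f x = dot (grad f x) v.
Proof.
move=> df; rewrite deriveE// {1}(row_sum_delta v) linear_sum.
apply: eq_bigr => i _; rewrite linearZ /= mxE -deriveE//.
by rewrite mulrC.
Qed.

(** A lower bound on directional derivatives that needs no differentiability:
    it is inherited by minima of functions, provided that the direction v is
    common. This is how kinks are handled below. *)
Definition uphill f x v (e : R) := exists2 r : R, 0 < r &
  forall y t, l2norm (y - x) < r -> 0 <= t < r -> f y + e * t <= f (y + t *: v).

Lemma derive_ge f x v (e r : R) : 0 < r -> differentiable f x ->
  (forall t, 0 <= t < r -> f x + e * t <= f (x + t *: v)) -> e <= 'D_v f x.
Proof.
move=> r0 /(@diff_derivable _ _ _ _ _ v) dfv H.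
have dfr : h^-1 *: (f (h *: v + x) - f x) @[h --> 0^'+] --> 'D_v f x.
  exact: cvg_dnbhs_at_right dfv.
rewrite -(cvg_lim _ dfr)//; apply: limr_ge; first exact: cvgP dfr.
near=> t; have t0 : 0 < t by near: t; exact: nbhs_right_gt.
have tr : t < r by near: t; exact: nbhs_right_lt.
have := H t; rewrite (ltW t0) tr addrC => /(_ isT) Ht.
suff : e <= (f (t *: v + x) - f x) / t by rewrite mulrC.
by rewrite ler_pdivlMr// [X in f X]addrC lerBrDr.
Unshelve. all: by end_near. Qed.

(** The gradients of f near x all have inner product at least e with v; this
    half-space condition survives limits and convex combinations, so no
    Clarke subgradient at x is shorter than e. *)
Lemma uphill_not_stationary f x v (e c : R) : l2norm v <= 1 -> c < e -> 0 < e ->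
  uphill f x v e -> ~ stationary c f x.
Proof.
move=> v1 ce e0 [r r0 fv] [u ux uc].
suff : e <= dot u v.
  move=> euv; have := le_trans euv (dot_le u v).
  have := l2norm_ge0 v; have := l2norm_ge0 u; nra.
apply: convex_hull_dot_ge ux => z [y [dy yx yz]].
have yzv : (fun k => dot (grad f (y k)) v) @ \oo --> dot z v.
  exact: (cvg_comp _ (fun u => dot u v) yz (@dot_continuousl _ _ v z)).
rewrite -(cvg_lim _ yzv)//; apply: limr_ge; first exact: cvgP yzv.
have yr : \forall k \near \oo, l2norm (y k - x) < r
  by exact: (yx _ (near_l2ball x r0)).
apply: filterS yr => k kr.
rewrite -differentiable_derive_dot//; apply: (derive_ge r0) => // t tr.
exact: fv.
Qed.

Lemma uphill_min f g x v e : uphill f x v e -> uphill g x v e ->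
  uphill (fun y => Num.min (f y) (g y)) x v e.
Proof.
move=> [r r0 fr] [q q0 gq]; exists (Num.min r q); first by rewrite lt_min r0.
move=> y t; rewrite lt_min => /andP[yr yq] /andP[t0];
  rewrite lt_min => /andP[tr tq].
rewrite le_min; apply/andP; split.
  by rewrite (le_trans _ (fr y t _ _)) ?t0// lerD2r ge_min lexx.
by rewrite (le_trans _ (gq y t _ _)) ?t0// lerD2r ge_min lexx orbT.
Qed.

(** Comparing g with a minorant f that agrees with it near x suffices. Global
    minoration spares the check that the endpoint of the step stays near x. *)
Lemma uphill_near f g x v e r : 0 < r ->
  (forall y, l2norm (y - x) < r -> f y = g y) ->
  (forall y, f y <= g y) -> uphill f x v e -> uphill g x v e.
Proof.
move=> r0 fg lefg [q q0 fq]; exists (Num.min r q); first by rewrite lt_min r0.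
move=> y t; rewrite lt_min => /andP[yr yq] /andP[t0];
  rewrite lt_min => /andP[tr tq].
by rewrite -fg// (le_trans (fq y t _ _)) ?t0.
Qed.

Lemma near_cst_grad f x (k : R) : (\forall y \near x, f y = k) -> grad f x = 0.
Proof.
move=> fk; apply/rowP => i; rewrite !mxE.
by rewrite (near_eq_derive (g := cst k))// derive_cst.
Qed.

Lemma near_cst_clarke f x (k : R) : (\forall y \near x, f y = k) ->
  clarke f x = [set 0].
Proof.
move=> fk; apply/seteqP; split=> u /=; last first.
  move=> ->; exists 1%N, (fun=> 1), (fun=> 0); split => //.
  - by rewrite big_ord1.
  - move=> _; exists (fun=> x); split.
    + by move=> _; exact: near_cst_differentiable fk.
    + exact: (cvg_cst x).
    + by apply: cvg_near_cst; apply: nearW => j; exact: near_cst_grad fk.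
  - by rewrite big_ord1 scaler0.
move=> [n [a [v [a0 a1 lv ->]]]]; apply: big1 => i _.
suff -> : v i = 0 by rewrite scaler0.
have [y [_ yx yv]] := lv i.
have yk : \forall j \near \oo, \forall z \near y j, f z = k.
  exact: (yx _ (near_join fk)).
have : \forall j \near \oo, grad f (y j) = 0.
  by apply: filterS yk => j; exact: near_cst_grad.
move=> /cvg_near_cst; exact: (cvg_unique _ yv).
Qed.

End Stationarity.

(** * Functions of one variable with a hidden minimum *)

Section Valley.
Context {R : realType} {K : nat}.
Hypothesis K_gt0 : (0 < K)%N.
Implicit Types (a b : 'I_K) (s u : seq 'I_K) (x y z : R).

(** The radius of a well relative to its parent. Consecutive centres are 4 *
    rad apart, which makes sibling wells disjoint, and 4 * rad * K = 1/8
    keeps the K centres in [0, 1/8]. *)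
Definition rad : R := (32 * K%:R)^-1.

Definition centre a : R := 4 * rad * a%:R.

(** Near centre a the function `|x| is replaced by a copy of valley s',
    scaled down by rad, and the two are joined by the shallow wedge 1/4 + `|x
    - centre a| / 2, which moves the vertex of `|x| to centre a without
    changing `|x| for `|x| >= 5/8. The slopes of the scaled copy are those of
    valley s', so that they do not degrade with the length of the word. *)
Fixpoint valley s x : R :=
  if s is a :: s' then
    Num.max `|x| (Num.min (1 / 4 + `|x - centre a| / 2)
      (3 / 16 + rad * valley s' ((x - centre a) / rad)))
  else `|x|.

Fixpoint bottom s : R :=
  if s is a :: s' then centre a + rad * bottom s' else 0.

Definition well s x := `|x - bottom s| <= rad ^+ size s.

Lemma rad_gt0 : 0 < rad.
Proof. by rewrite invr_gt0 mulr_gt0// ltr0n. Qed.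

Lemma norm_div_rad x : `|x / rad| = `|x| / rad.
Proof. by rewrite normrM (@gtr0_norm _ rad^-1)// invr_gt0 rad_gt0. Qed.

Lemma rad_le : rad <= 1 / 32.
Proof.
have K1 : 1 <= K%:R :> R by rewrite ler1n.
by rewrite /rad invfM div1r ler_piMr// invf_le1// ltr0n.
Qed.

Lemma centre_bounds a : 0 <= centre a <= 1 / 8.
Proof.
have := rad_gt0; rewrite /centre => r0; apply/andP; split.
  by rewrite mulr_ge0// mulr_ge0// ltW.
have K0 : 0 < K%:R :> R by rewrite ltr0n.
have -> : 1 / 8 = 4 * rad * K%:R by rewrite /rad; field; rewrite gt_eqF.
by rewrite ler_pM2l ?ler_nat ?(ltnW (ltn_ord a))// mulr_gt0.
Qed.

Lemma bottom_le s : `|bottom s| <= 1 / 4.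
Proof.
elim: s => [|a s]; first by rewrite normr0.
have := centre_bounds a; have := rad_gt0; have := rad_le;
  rewrite !ler_norml /=; nra.
Qed.

Lemma valley_ge_norm s x : `|x| <= valley s x.
Proof. by case: s => [|a s] //=; rewrite le_max lexx. Qed.

Lemma valley_le1 s x : `|x| <= 1 -> valley s x <= 1.
Proof.
case: s => [//|a s] x1 /=; rewrite ge_max x1 ge_min /=; apply/orP; left.
have := ler_normB x (centre a); have := centre_bounds a => /andP[c0].
by rewrite (ger0_norm c0); lra.
Qed.

Lemma valley_out s x : 1 <= `|x| -> valley s x = `|x|.
Proof.
case: s => [//|a s] x1 /=; apply/max_idPl; rewrite ge_min; apply/orP; left.
have := ler_normB x (centre a); have := centre_bounds a => /andP[c0].
by rewrite (ger0_norm c0); lra.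
Qed.

Lemma rad_valley_ge s x : `|x| <= rad * valley s (x / rad).
Proof.
rewrite -ler_pdivrMl ?rad_gt0// (le_trans _ (valley_ge_norm _ _))//.
by rewrite norm_div_rad mulrC.
Qed.

Lemma rad_valley_out s x : rad <= `|x| -> rad * valley s (x / rad) = `|x|.
Proof.
have r0 := rad_gt0 => rx.
by rewrite valley_out norm_div_rad ?ler_pdivlMr ?mul1r// mulrC divfK// gt_eqF.
Qed.

(** Within 1/8 of the centre the inner copy is the active piece: it lies
    below the shallow wedge and above `|x|. *)
Lemma valley_mid a s x : `|x - centre a| <= 1 / 8 ->
  valley (a :: s) x = 3 / 16 + rad * valley s ((x - centre a) / rad).
Proof.
move=> xa /=; set H := rad * _; have r0 := rad_gt0; have rle := rad_le.
have cH : `|x - centre a| <= H by exact: rad_valley_ge.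
have Hle : H <= 1 / 16 + `|x - centre a| / 2.
  have [rx|xr] := leP rad `|x - centre a|;
    first by rewrite /H rad_valley_out//; lra.
  have : H <= rad * 1.
    rewrite ler_pM2l// valley_le1// norm_div_rad.
    by rewrite ler_pdivrMr// mul1r ltW.
  have := normr_ge0 (x - centre a); lra.
have -> : Num.min (1 / 4 + `|x - centre a| / 2) (3 / 16 + H) = 3 / 16 + H.
  by apply/min_idPr; lra.
apply/max_idPr; have := ler_normD (x - centre a) (centre a); rewrite subrK.
have := centre_bounds a => /andP[c0]; rewrite (ger0_norm c0); lra.
Qed.

(** Beyond 1/8 from the centre the shallow wedge takes over: the inner copy
    is at least `|x - centre a|, and 3/16 + r >= 1/4 + r/2 exactly when r >=
    1/8. *)
Lemma valley_far a s x : 1 / 8 <= `|x - centre a| ->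
  valley (a :: s) x = Num.max `|x| (1 / 4 + `|x - centre a| / 2).
Proof.
move=> xa /=; congr Num.max; apply/min_idPl.
have := rad_valley_ge s (x - centre a); lra.
Qed.

Lemma valley_lip s x y : valley s x <= valley s y + `|x - y|.
Proof.
have r0 := rad_gt0.
elim: s x y => [|a s IHs] x y; first by have := ler_normD y (x - y);
  rewrite addrC subrK addrC.
have lin : `|x| <= `|y| + `|x - y|.
  by have := ler_normD y (x - y); rewrite addrC subrK.
have lin2 : `|x - centre a| <= `|y - centre a| + `|x - y|.
  by have := ler_normD (x - y) (y - centre a); rewrite subrKA; lra.
have lin3 : rad * valley s ((x - centre a) / rad) <=
    rad * valley s ((y - centre a) / rad) + `|x - y|.
  have -> : `|x - y| = rad * `|(x - centre a) / rad - (y - centre a) / rad|.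
    rewrite -mulrBl norm_div_rad opprB addrA subrK.
    by rewrite mulrC divfK// gt_eqF.
  by rewrite -mulrDr ler_pM2l.
have := normr_ge0 (x - y).
by rewrite /= addr_maxl addr_minl => ?; rewrite le_max2// le_min2//; lra.
Qed.

Lemma rad_scale_le x y (t : R) :
  (`|x - y| <= rad * t) = (`|x / rad - y / rad| <= t).
Proof.
have r0 := rad_gt0.
rewrite -mulrBl norm_div_rad.
by rewrite ler_pdivrMr// mulrC.
Qed.

(** The sign e treats both sides of the minimum at once. Two regimes are
    glued at distance 1/8 from the centre: inside, the slope is that of the
    scaled copy, hence at least 1/2 by induction; outside, it is that of `|x|
    or of the wedge. *)
Lemma valley_slope s (e u t : R) : e = 1 \/ e = -1 -> e * bottom s <= u ->
  0 <= t ->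
  valley s (e * u) + t / 2 <= valley s (e * (u + t)).
Proof.
have r0 := rad_gt0 => e1.
have ee : e * e = 1 by case: e1 => ->; rewrite ?mulrNN mulr1.
have ne x : `|e * x| = `|x| by rewrite normrM; case: e1 => ->;
  rewrite ?normrN normr1 mul1r.
elim: s u t => [|a s IHs] u t.
  rewrite /= mulr0 => u0 t0; rewrite !ne !ger0_norm ?addr_ge0//; lra.
pose q := e * centre a.
have q18 : - (1 / 8) <= q <= 1 / 8.
  by have := centre_bounds a; rewrite /q; case: e1 => ->; lra.
have reflect x : e * x - centre a = e * (x - q).
  by rewrite mulrBr /q mulrA ee mul1r.
have mid x : `|x - q| <= 1 / 8 ->
    valley (a :: s) (e * x) = 3 / 16 + rad * valley s (e * ((x - q) / rad)).
  by move=> xq; rewrite valley_mid reflect ?ne// mulrA.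
have far x : 1 / 8 <= x - q -> valley (a :: s) (e * x) =
  Num.max x (1 / 4 + (x - q) / 2).
  move=> xq; rewrite valley_far reflect ne ?(le_trans xq) ?ler_norm//.
  by rewrite ne !ger0_norm//; lra.
have midmid x y : e * bottom s <= (x - q) / rad -> x <= y -> y <= q + 1 / 8 ->
    valley (a :: s) (e * x) + (y - x) / 2 <= valley (a :: s) (e * y).
  move=> bx xy yq.
  have xq : - (1 / 8) <= x - q.
    have := bottom_le s; rewrite ler_norml => bs.
    have eb : - (1 / 4) <= e * bottom s by case: e1 => ->; lra.
    have := le_trans eb bx; rewrite ler_pdivlMr//; have := rad_le; lra.
  rewrite !mid ?ler_norml; [|lra|lra].
  have t0 : 0 <= (y - x) / rad by apply: divr_ge0; [lra|exact: ltW].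
  have := IHs _ _ bx t0; rewrite -mulrDl => h.
  have -> : y - q = x - q + (y - x) by lra.
  have := ler_wpM2l (ltW r0) h; rewrite mulrDr.
  have -> : rad * ((y - x) / rad / 2) = (y - x) / 2 by field; rewrite gt_eqF.
  lra.
have farfar x y : q + 1 / 8 <= x -> x <= y ->
    valley (a :: s) (e * x) + (y - x) / 2 <= valley (a :: s) (e * y).
  move=> qx xy; rewrite !far; [|lra|lra].
  by rewrite addr_maxl le_max2//; lra.
move=> bu t0; have {}bu : q + e * (rad * bottom s) <= u by rewrite -mulrDr.
have bu' : e * bottom s <= (u - q) / rad by rewrite ler_pdivlMr//; lra.
have tE : t = u + t - u by rewrite addrC addKr.
have [utm|/ltW utm] := leP (u + t) (q + 1 / 8).
  by rewrite [t in t / 2]tE; apply: midmid => //; lra.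
have [um|/ltW um] := leP u (q + 1 / 8).
  have bm : u <= q + 1 / 8 by [].
  have := midmid _ _ bu' bm (lexx _); have := farfar _ _ (lexx _) utm; lra.
by rewrite [t in t / 2]tE; apply: farfar => //; lra.
Qed.

Lemma well_cons a s x : well (a :: s) x = well s ((x - centre a) / rad).
Proof.
rewrite /well /= exprS opprD addrA rad_scale_le.
by rewrite [rad * _ / rad]mulrAC divff ?mul1r// gt_eqF// rad_gt0.
Qed.

(** Outside [-1, 1] all the functions valley s are equal to `|x|; this is
    carried by scaling to the well of any prefix. *)
Lemma valley_prefix u s s' x : ~~ well u x ->
  valley (u ++ s) x = valley (u ++ s') x.
Proof.
elim: u x => [|a u IHu] x.
  by rewrite /well /= subr0 -ltNge => /ltW x1; rewrite !valley_out.
by rewrite well_cons => /IHu /= ->.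
Qed.

Lemma well_prefix u s x : well (u ++ s) x -> well u x.
Proof.
elim: u x => [|a u IHu] x; last by rewrite /= !well_cons; exact: IHu.
rewrite /= /well /= subr0; case: s => [|a s]; first by rewrite /= subr0.
have := bottom_le (a :: s); move: (bottom _) => b bb xb.
have : rad ^+ size (a :: s) <= 1 / 32.
  rewrite /= exprS (le_trans _ rad_le)// ler_piMr ?(ltW rad_gt0)//.
  by rewrite exprn_ile1 ?(ltW rad_gt0)//; have := rad_le; lra.
have := ler_normD (x - b) b; rewrite subrK; lra.
Qed.

Lemma well_disjoint u a b x : well (rcons u a) x -> well (rcons u b) x -> a = b.
Proof.
elim: u x => [|c u IHu] x; last by rewrite /= !well_cons; exact: IHu.
rewrite /= !well_cons /well /= !subr0 expr0 => xa xb.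
have r0 := rad_gt0.
have : `|(x - centre b) / rad - (x - centre a) / rad| < 4 * 1.
  have := ler_normB ((x - centre b) / rad) ((x - centre a) / rad); lra.
rewrite -mulrBl [X in X / rad](_ : _ = rad * (4 * (a%:R - b%:R)));
  last by rewrite /centre; lra.
rewrite mulrAC divff ?gt_eqF// mul1r normrM (gtr0_norm (x := 4))// ltr_pM2l//.
move=> ab; apply/val_inj => /=; move: ab.
rewrite ltr_norml => /andP[ab ba].
have : b%:R < a.+1%:R :> R by rewrite -natr1; lra.
have : a%:R < b.+1%:R :> R by rewrite -natr1; lra.
by rewrite !ltr_nat !ltnS => ? ?; apply/eqP; rewrite eqn_leq; apply/andP.
Qed.

End Valley.
Arguments rad : clear implicits.

(** * The hard functions *)

Section Landscape.
Context {R : realType} {d K : nat} (i0 : 'I_d).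
Hypothesis K_gt0 : (0 < K)%N.
Implicit Types (x y v W : 'rV[R]_d) (s : seq 'I_K).

Definition off x : 'rV[R]_d := \row_i (if i == i0 then 0 else x ord0 i).

Definition base s x := valley s (x ord0 i0) + l2norm (off x).

(** For a unit vector W orthogonal to the axis i0, positive when the angle
    between W and off x has cosine above 30/32. The coefficient 32 exceeds 30
    + 1, so that inside the cone |off x| - cone W x decreases along W; the
    ratio 30/32 is close enough to 1 for distant sign vectors to have
    disjoint cones. *)
Definition cone W x := 32 * dot W x - 30 * l2norm (off x).

(** The cone thickened by rad ^ |s| at the minimum of the valley, so as to
    contain it, and thinned away from it: outside the well of s the set where
    channel is positive lies inside the cone, so that nothing but the cone
    can reveal W there. *)
Definition channel s W x :=
  cone W x + (rad R K ^+ size s - `|x ord0 i0 - bottom s|).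

Definition landscape s W x := Num.min (base s x) (base s x - channel s W x).

Definition hard s W x := Num.max (- 1) (landscape s W x).

Lemma offD x y : off (x + y) = off x + off y.
Proof. by apply/rowP => i; rewrite !mxE; case: ifP; rewrite ?addr0. Qed.

Lemma offZ a x : off (a *: x) = a *: off x.
Proof. by apply/rowP => i; rewrite !mxE; case: ifP; rewrite ?mulr0. Qed.

Lemma offB x y : off (x - y) = off x - off y.
Proof. by rewrite -scaleN1r offD offZ scaleN1r. Qed.

Lemma off_off x : off (off x) = off x.
Proof. by apply/rowP => i; rewrite !mxE; case: eqP. Qed.

Lemma off_id W : W ord0 i0 = 0 -> off W = W.
Proof. by move=> W0; apply/rowP => i; rewrite !mxE; case: eqP => [->|//];
  rewrite W0. Qed.

Lemma dot_off W x : dot (off W) x = dot (off W) (off x).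
Proof. by apply: eq_bigr => i _; rewrite !mxE; case: ifP; rewrite ?mul0r. Qed.

Lemma l2norm_off_le x : l2norm (off x) <= l2norm x.
Proof.
rewrite /l2norm ler_wsqrtr// ler_sum// => i _; rewrite mxE.
by case: ifP => // _; rewrite expr0n sqr_ge0.
Qed.

Lemma off_delta : off (delta_mx ord0 i0) = 0.
Proof. by apply/rowP => i; rewrite !mxE; case: (i == i0). Qed.

Lemma l2norm_delta : l2norm (delta_mx ord0 i0 : 'rV[R]_d) = 1.
Proof.
rewrite /l2norm (bigD1 i0)//= big1 ?mxE ?eqxx ?addr0 ?expr1n ?sqrtr1// => i
  /negPf ii0.
by rewrite mxE ii0 andbF expr0n.
Qed.

Lemma l2norm_off_lip x y : l2norm (off x) <= l2norm (off y) + l2norm (x - y).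
Proof.
have := l2normD (off y) (off (x - y)); rewrite -offD addrC subrK.
have := l2norm_off_le (x - y); lra.
Qed.

Lemma base_lip s x y : base s x <= base s y + 2 * l2norm (x - y).
Proof.
have := valley_lip K_gt0 s (x ord0 i0) (y ord0 i0).
have := coord_le (x - y) i0; rewrite !mxE => xy.
have := l2norm_off_lip x y; rewrite /base; lra.
Qed.

Lemma channel_lip s W x y : l2norm W <= 1 ->
  channel s W x <= channel s W y + 63 * l2norm (x - y).
Proof.
move=> W1; have := coord_le (x - y) i0; rewrite !mxE => xy.
have := ler_normD (x ord0 i0 - y ord0 i0) (bottom s - x ord0 i0).
have -> : x ord0 i0 - y ord0 i0 + (bottom s - x ord0 i0) =
  bottom s - y ord0 i0 by lra.
rewrite !(distrC (bottom s)) => tri.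
have := dot_le W (x - y); rewrite dotDr dotNr => dxy.
have : l2norm W * l2norm (x - y) <= l2norm (x - y).
  by rewrite ler_piMl ?l2norm_ge0.
have := l2norm_off_lip y x; rewrite (l2normB y x) /channel /cone; lra.
Qed.

Lemma landscape_lip s W x y : l2norm W <= 1 ->
  landscape s W x <= landscape s W y + 65 * l2norm (x - y).
Proof.
move=> W1; have := base_lip s x y; have := channel_lip s y x W1.
rewrite (l2normB y x) => cl bl; have := l2norm_ge0 (x - y) => n0.
by rewrite /landscape addr_minl le_min2//; lra.
Qed.

Lemma hard_lipschitz s W : l2norm W <= 1 -> l2_lipschitz 65 (hard s W).
Proof.
move=> W1.
have H x y : hard s W x <= hard s W y + 65 * l2norm (x - y).
  rewrite /hard addr_maxl le_max2 ?landscape_lip// lerDl.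
  by rewrite mulr_ge0// l2norm_ge0.
move=> x y; rewrite ler_norml; have := H x y; have := H y x.
rewrite (l2normB y x); lra.
Qed.

(** Off the hyperplane x_i0 = bottom s, move along the axis away from bottom
    s: the valley rises with slope 1/2, and the channel only gets thinner. *)
Lemma uphill_axis s W x : W ord0 i0 = 0 -> x ord0 i0 != bottom s ->
  exists2 v, l2norm v <= 1 & uphill (landscape s W) x v (1 / 2).
Proof.
move=> W0 xb.
have [e e1 exb] : exists2 e : R, e = 1 \/ e = -1 &
    0 < e * (x ord0 i0 - bottom s).
  have [h|h|h] := ltgtP (x ord0 i0) (bottom s); last by rewrite h eqxx in xb.
    by exists (-1); [right|lra].
  by exists 1; [left|lra].
have ee : e * e = 1 by case: e1 => ->; rewrite ?mulrNN mulr1.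
exists (e *: delta_mx ord0 i0).
  by rewrite l2normZ l2norm_delta; case: e1 => ->; rewrite ?normrN normr1 mul1r.
have offE y t : off (y + t *: (e *: delta_mx ord0 i0)) = off y.
  by rewrite offD !offZ off_delta !scaler0 addr0.
have xE y t : (y + t *: (e *: delta_mx ord0 i0)) ord0 i0 = y ord0 i0 + t * e.
  by rewrite !mxE !eqxx mulr1.
have dE y t : dot W (y + t *: (e *: delta_mx ord0 i0)) = dot W y.
  by rewrite -(off_id W0) dot_off offE -dot_off.
have r0 : 0 < `|x ord0 i0 - bottom s| by rewrite normr_gt0 subr_eq0.
have side y : l2norm (y - x) < `|x ord0 i0 - bottom s| ->
  0 <= e * (y ord0 i0 - bottom s).
  move=> yx; have := le_lt_trans (coord_le (y - x) i0) yx;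
    rewrite !mxE ltr_norml.
  have -> : `|x ord0 i0 - bottom s| = e * (x ord0 i0 - bottom s).
    rewrite -(gtr0_norm exb) normrM; case: e1 => ->;
      rewrite ?normrN normr1 mul1r//.
  by case: e1 => -> /andP[]; lra.
have slope y t : l2norm (y - x) < `|x ord0 i0 - bottom s| -> 0 <= t ->
    valley s (y ord0 i0) + t / 2 <= valley s (y ord0 i0 + t * e).
  move=> yx t0; have eb : e * bottom s <= e * y ord0 i0 by have := side _ yx;
    lra.
  have := valley_slope K_gt0 e1 eb t0.
  by rewrite mulrDr mulrA ee mul1r (mulrC e t).
apply: uphill_min; exists `|x ord0 i0 - bottom s| => // y t yx /andP[t0 _];
  have := slope _ _ yx t0; rewrite /channel /base /cone !offE !xE ?dE;
    first lra.
suff : `|y ord0 i0 - bottom s| <= `|y ord0 i0 + t * e - bottom s| by lra.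
have := side _ yx; have ne z : `|e * z| = `|z|.
  by rewrite normrM; case: e1 => ->; rewrite ?normrN normr1 mul1r.
rewrite -(ne (_ - _)) -(ne (_ + _ - _)) => h.
have te : e * (y ord0 i0 + t * e - bottom s) =
  e * (y ord0 i0 - bottom s) + t * (e * e) by ring.
by rewrite te ee mulr1 !ger0_norm ?addr_ge0// lerDl.
Qed.

(** Inside the channel the landscape is base - channel, whose part 31 |off x|
    - 32 <W, x> grows at rate at least 32 - 31 along -W. *)
Lemma uphill_channel s W x : W ord0 i0 = 0 -> l2norm W = 1 ->
  0 < channel s W x ->
  exists2 v, l2norm v <= 1 & uphill (landscape s W) x v (1 / 2).
Proof.
move=> W0 W1 x0; have W1le : l2norm W <= 1 by rewrite W1.
exists (- W); first by rewrite l2normN W1.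
exists (channel s W x / 200); first by rewrite divr_gt0.
have landE z : l2norm (z - x) < channel s W x / 100 ->
    landscape s W z = base s z - channel s W z.
  move=> zx; apply/min_idPr; rewrite gerBl.
  have := channel_lip s x z W1le; rewrite (l2normB x z); lra.
move=> y t yx /andP[t0 tr].
have tW : l2norm (t *: - W) = t by rewrite l2normZ l2normN W1 mulr1 ger0_norm.
have ytx : l2norm (y + t *: - W - x) < channel s W x / 100.
  by have := l2normD (y - x) (t *: - W); rewrite addrAC tW; lra.
rewrite !landE//; last lra.
have := l2norm_off_lip y (y + t *: - W).
rewrite opprD addNKr l2normN tW /base /channel /cone.
have -> : (y + t *: - W) ord0 i0 = y ord0 i0.
  by rewrite !mxE W0 oppr0 mulr0 addr0.
rewrite dotDr dotZr dotNr -l2norm_sqr W1; lra.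
Qed.

(** On the hyperplane and outside the channel, move radially. The norm |off
    x| grows at rate almost 1, and <W, v> <= 30/32 holds because channel <= 0
    where the thickening is largest; hence 31 |off x| - 32 <W, x> grows as
    well. This direction thus works for both pieces of the minimum, including
    on the boundary of the channel. *)
Lemma uphill_off s W x : W ord0 i0 = 0 -> x ord0 i0 = bottom s ->
  channel s W x <= 0 ->
  exists2 v, l2norm v <= 1 & uphill (landscape s W) x v (1 / 2).
Proof.
move=> W0 xb; rewrite /channel /cone xb subrr normr0 subr0.
have := exprn_gt0 (size s) (@rad_gt0 R K K_gt0).
set h := rad R K ^+ _; set m := l2norm (off x) => h0 x0.
have m0 : 0 < m.
  rewrite lt_neqAle l2norm_ge0 andbT; apply/eqP => m0.
  move: x0; rewrite -m0 -(off_id W0) dot_off.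
  rewrite [off x](l2norm_eq0 _)// /dot big1; first lra.
  by move=> i _; rewrite [X in _ * X]mxE mulr0.
pose v := m^-1 *: off x.
have offv : off v = v by rewrite /v offZ off_off.
have v0 : v ord0 i0 = 0 by rewrite /v !mxE eqxx mulr0.
have v1 : l2norm v = 1 by rewrite l2normZ ger0_norm ?invr_ge0 ?ltW// mulVf//
  gt_eqF.
have Wv : 32 * dot W v <= 30.
  rewrite /v dotZr mulrCA -ler_pdivlMl ?invr_gt0// invrK.
  rewrite -(off_id W0) -dot_off off_id//; lra.
(* The radial direction v is that of x, not of y: off (y + t v) differs from
   the dilation of off y by the factor 1 + t / m only by a multiple of off (y
   - x), and a neighbourhood of radius m / 200 makes the loss at most t /
   100. *)
have rise y t : l2norm (y - x) < m / 200 -> 0 <= t ->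
    l2norm (off y) + 99 / 100 * t <= l2norm (off (y + t *: v)).
  move=> yx t0.
  have yxo := le_lt_trans (l2norm_off_le (y - x)) yx.
  have ym : m - m / 200 <= l2norm (off y).
    by have := l2norm_off_lip x y; rewrite (l2normB x y) -/m; lra.
  have tm0 : 0 <= t / m by apply: divr_ge0 => //; exact: ltW.
  have : l2norm ((1 + t / m) *: off y) <=
    l2norm (off (y + t *: v)) + t / m * l2norm (off (y - x)).
    have -> : (1 + t / m) *: off y = off (y + t *: v) + t / m *: off (y - x).
      rewrite offD offZ offv offB /v scalerA scalerDl scale1r scalerBr -addrA;
        congr (_ + _).
      by rewrite addrCA subrr addr0.
    by rewrite (le_trans (l2normD _ _))// l2normZ (ger0_norm tm0).
  rewrite l2normZ ger0_norm ?addr_ge0// mulrDl mul1r => H.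
  have tE : t = t / m * m by rewrite divfK// gt_eqF.
  set a := t / m in H tE tm0; rewrite {1}tE; nra.
exists v; first by rewrite v1.
apply: uphill_min; exists (m / 200); rewrite ?divr_gt0// => y t yx /andP[t0 _];
  have := rise _ _ yx t0; rewrite /base /channel /cone.
- have -> : (y + t *: v) ord0 i0 = y ord0 i0.
    by rewrite mxE [X in _ + X]mxE v0 mulr0 addr0.
  lra.
- have -> : (y + t *: v) ord0 i0 = y ord0 i0.
    by rewrite mxE [X in _ + X]mxE v0 mulr0 addr0.
  rewrite dotDr dotZr; nra.
Qed.

Lemma landscape_uphill s W x : W ord0 i0 = 0 -> l2norm W = 1 ->
  exists2 v, l2norm v <= 1 & uphill (landscape s W) x v (1 / 2).
Proof.
move=> W0 W1; have [xb|/eqP xb] := eqVneq (x ord0 i0) (bottom s).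
  by have [|] := leP (channel s W x) 0;
    [exact: uphill_off|exact: uphill_channel].
by apply: uphill_axis => //; exact/eqP.
Qed.

Lemma stationary_hard s W x c : W ord0 i0 = 0 -> l2norm W = 1 -> c < 1 / 2 ->
  stationary c (hard s W) x -> hard s W x = - 1.
Proof.
move=> W0 W1 c12 xc; have W1le : l2norm W <= 1 by rewrite W1.
apply/max_idPl; rewrite leNgt; apply/negP => lx.
have [v v1 xv] := landscape_uphill s x W0 W1.
apply: (uphill_not_stationary v1 c12 _ _ xc); first lra.
apply: (uphill_near (r := (landscape s W x + 1) / 65)) xv; first lra.
  move=> y yx; apply/esym/max_idPr.
  have := landscape_lip s x y W1le; rewrite (l2normB x y); lra.
by move=> y; rewrite le_max lexx orbT.
Qed.

Lemma base_ge0 s x : 0 <= base s x.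
Proof.
rewrite addr_ge0 ?l2norm_ge0//.
by rewrite (le_trans _ (valley_ge_norm _ _)).
Qed.

Lemma hard_channel_le0 s W x : channel s W x <= 0 -> hard s W x = base s x.
Proof.
move=> cx; rewrite /hard /landscape; have := base_ge0 s x => b0.
have -> : Num.min (base s x) (base s x - channel s W x) = base s x.
  by apply/min_idPl; lra.
by apply/max_idPr; lra.
Qed.

Lemma channel_lt0 s W x : ~~ well s (x ord0 i0) -> cone W x <= 0 ->
  channel s W x < 0.
Proof. by rewrite /well -ltNge /channel; lra. Qed.

Lemma hard_near_base s W x : ~~ well s (x ord0 i0) -> cone W x <= 0 ->
  l2norm W <= 1 -> \forall y \near x, hard s W y = base s y.
Proof.
move=> xs xW W1; have cx := channel_lt0 xs xW.
near=> y; apply: hard_channel_le0.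
have : l2norm (y - x) < - channel s W x / 63.
  by near: y; apply: near_l2ball; lra.
have := channel_lip s y x W1; lra.
Unshelve. all: by end_near. Qed.

(** On the axis of the channel |off x| = <W, x> = a, so that base - channel
    is at most 1 + a - 2 a, which is below -1 as soon as a >= 3. The
    truncation is then locally constant. *)
Lemma hard_flat s W (a : R) : W ord0 i0 = 0 -> l2norm W = 1 -> 3 <= a ->
  let x := bottom s *: delta_mx ord0 i0 + a *: W in
  (\forall y \near x, hard s W y = - 1) /\ l2norm x <= 1 + a.
Proof.
move=> W0 W1 a3 x; have W1le : l2norm W <= 1 by rewrite W1.
have a0 : 0 <= a by lra.
have bs := @bottom_le R K K_gt0 s.
have xi : x ord0 i0 = bottom s by rewrite !mxE W0 !eqxx mulr1 mulr0 addr0.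
have ox : off x = a *: W by rewrite offD !offZ off_delta scaler0 add0r off_id.
have nx : l2norm (off x) = a by rewrite ox l2normZ W1 mulr1 ger0_norm.
have dx : dot W x = a.
  by rewrite -(off_id W0) dot_off ox off_id// dotZr -l2norm_sqr W1 expr1n mulr1.
split; last first.
  have := l2normD (bottom s *: delta_mx ord0 i0) (a *: W).
  by rewrite !l2normZ W1 l2norm_delta -/x (ger0_norm a0); lra.
have lx : landscape s W x < -1.
  rewrite /landscape gt_min; apply/orP; right.
  rewrite /base /channel /cone xi nx dx subrr normr0.
  have b1 : `|bottom s| <= 1 :> R by apply: (le_trans bs); lra.
  have := valley_le1 K_gt0 s b1; have :=
    exprn_gt0 (size s) (@rad_gt0 R K K_gt0); lra.
near=> y; apply/max_idPl.
have : l2norm (y - x) < (-1 - landscape s W x) / 65.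
  by near: y; apply: near_l2ball; lra.
have := landscape_lip s y x W1le; lra.
Unshelve. all: by end_near. Qed.

End Landscape.

(** * Sign vectors as hidden directions *)

Section Directions.
Context {R : realType} {d : nat} (i0 : 'I_d).
Hypothesis d_gt1 : (1 < d)%N.
Implicit Types (x : 'rV[R]_d) (w : {ffun 'I_d -> bool}).

(** The coordinate i0 is erased, so w i0 is a dummy sign: the index set is
    that of all sign vectors, at the cost of counting each direction twice. *)
Definition sgnvec w : 'rV[R]_d :=
  \row_i (if i == i0 then 0 else (-1) ^+ w i / Num.sqrt d.-1%:R).

Definition mismatch w w' := #|[set i | (i != i0) && (w i != w' i)]%SET|.

Lemma sgnvec_axis w : sgnvec w ord0 i0 = 0.
Proof. by rewrite mxE eqxx. Qed.

Lemma dot_sgnvec w w' :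
  dot (sgnvec w) (sgnvec w') = 1 - 2 * (mismatch w w')%:R / d.-1%:R.
Proof.
have dp : 0 < d.-1%:R :> R by rewrite ltr0n -subn1 subn_gt0.
have sq : (Num.sqrt d.-1%:R : R)^-1 * (Num.sqrt d.-1%:R)^-1 = d.-1%:R^-1.
  by rewrite -invfM -expr2 sqr_sqrtr// ltW.
rewrite /dot (eq_bigr (fun i => (if i != i0 then d.-1%:R^-1 else 0) -
   (if (i != i0) && (w i != w' i) then 2 / d.-1%:R else 0 : R))); last first.
  move=> i _; rewrite !mxE; case: eqP => _ /=; first by rewrite mul0r subr0.
  rewrite mulrACA sq; case: (w i) (w' i) => [] [] /=; lra.
rewrite sumrB -!big_mkcond /= !sumr_const.
rewrite (_ : #|[pred i | i != i0]| = d.-1); last by rewrite cardC1 card_ord.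
rewrite -[_ *+ d.-1]mulr_natr mulVf ?gt_eqF//; congr (_ - _).
by rewrite /mismatch cardsE -[LHS]mulr_natr mulrAC.
Qed.

Lemma l2norm_sgnvec w : l2norm (sgnvec w) = 1.
Proof.
rewrite l2normE dot_sgnvec /mismatch (_ : [set _ | _]%SET = finset.set0).
  by rewrite cards0 mulr0 mul0r subr0 sqrtr1.
by apply/setP => i; rewrite !inE eqxx andbF.
Qed.

(** If both unit vectors are within the cone angle of x then their sum has
    norm at least 15/8, which forces their inner product to be at least
    97/128 > 3/4. *)
Lemma cone_mismatch w w' x : 0 < cone i0 (sgnvec w) x ->
  0 < cone i0 (sgnvec w') x ->
  (mismatch w w' <= d %/ 8)%N.
Proof.
rewrite /cone => wx w'x; set m := l2norm (off i0 x) in wx w'x.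
have dp : 0 < d.-1%:R :> R by rewrite ltr0n -subn1 subn_gt0.
have sx u : dot (sgnvec u) x = dot (sgnvec u) (off i0 x).
  by rewrite -(off_id (sgnvec_axis u)) dot_off.
have cs := dot_le (sgnvec w + sgnvec w') (off i0 x).
have nn := l2norm_sqr (sgnvec w + sgnvec w').
move: nn; rewrite !(dotDl, dotDr) (dotC (sgnvec w') (sgnvec w)) -!l2norm_sqr
  !l2norm_sgnvec.
rewrite dot_sgnvec; move: cs; rewrite dotDl -!sx -/m.
have m0 : 0 <= m by exact: l2norm_ge0.
have := l2norm_ge0 (sgnvec w + sgnvec w').
set N := l2norm _ => N0 cs nn.
have mp : 0 < m.
  rewrite lt_neqAle m0 andbT; apply/eqP => m00; move: cs wx w'x; rewrite -m00;
    lra.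
have N158 : 15 / 8 <= N by rewrite -(ler_pM2r mp); lra.
have : 225 / 64 <= N ^+ 2 by rewrite expr2; nra.
rewrite nn => H.
have : 2 * (mismatch w w')%:R / d.-1%:R <= 1 / 4 :> R by lra.
rewrite ler_pdivrMr// => H2.
have : (8 * (mismatch w w'))%:R <= d.-1%:R :> R by rewrite natrM; lra.
rewrite ler_nat leq_divRL// mulnC => h; apply: leq_trans h _; exact: leq_pred.
Qed.

(** The base 15/16 is large enough for 4 * (5/8)^8 <= (15/16)^8, which
    absorbs eight factors at a time. *)
Lemma geometric_bound : 4 ^+ (d %/ 8) * (5 / 8) ^+ d <= (15 / 16) ^+ d :> R.
Proof.
rewrite [in (5 / 8) ^+ d](divn_eq d 8) [in leRHS](divn_eq d 8).
rewrite !exprD mulrA !(mulnC _ 8) !exprM -exprMn.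
apply: ler_pM; rewrite ?exprn_ge0// ?mulr_ge0 ?exprn_ge0//; try lra.
  by apply: lerXn2r; rewrite ?nnegrE ?mulr_ge0 ?exprn_ge0//; lra.
by apply: lerXn2r; rewrite ?nnegrE; lra.
Qed.

(** The sum factorizes over the coordinates: the dummy one contributes 2,
    each other one 1 + 1/4. *)
Lemma sum_mismatch w0 :
  \sum_w (1 / 4) ^+ mismatch w w0 <= 2 * (5 / 4) ^+ d :> R.
Proof.
pose F i (b : bool) : R := if (i != i0) && (b != w0 i) then 1 / 4 else 1.
rewrite (eq_bigr (fun w : {ffun 'I_d -> bool} => \prod_i F i (w i)));
  last first.
  by move=> w _; rewrite /F -big_mkcond prodr_const /mismatch cardsE.
rewrite -(bigA_distr_bigA F) (bigD1 i0)//=.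
rewrite big_bool /F eqxx /= -[1 + 1]/(2 : R) ler_pM2l//.
rewrite (eq_bigr (fun=> 5 / 4)); last first.
  by move=> i ->; rewrite big_bool; case: (w0 i) => /=; lra.
rewrite prodr_const cardC1 card_ord ler_weXn2l ?leq_pred//; lra.
Qed.

(** Sign vectors whose cones contain x are in a Hamming ball of radius d / 8
    around any one of them. Weighting each w by (1/4) ^ mismatch bounds the
    size of this ball without binomial coefficients. *)
Lemma card_cone x :
  #|[set w | 0 < cone i0 (sgnvec w) x]%SET|%:R <=
    2 ^+ d * (2 * (15 / 16) ^+ d) :> R.
Proof.
have [/eqP ->|/set0Pn[w0]] := boolP ([set w | 0 < cone i0 (sgnvec w) x]%SET ==
  finset.set0).
  by rewrite cards0 !mulr_ge0// exprn_ge0//; lra.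
rewrite inE => w0x.
have q0 : 0 < 4 ^+ (d %/ 8) :> R by exact: exprn_gt0.
have : #|[set w | 0 < cone i0 (sgnvec w) x]%SET|%:R / 4 ^+ (d %/ 8) <=
  2 * (5 / 4) ^+ d :> R.
  apply: le_trans (sum_mismatch w0).
  rewrite [leRHS](bigID (fun w => 0 < cone i0 (sgnvec w) x)) /=.
  rewrite -[leLHS]addr0 lerD//; last by apply: sumr_ge0 => w _;
    rewrite exprn_ge0.
  rewrite -sum1_card natr_sum mulr_suml big_set/=.
  apply: ler_sum => w wx; rewrite -exprVn !mul1r ler_wiXn2l ?invr_ge0
    ?invf_le1//.
  - by rewrite ler1n.
  - by move: wx; rewrite ?inE => wx; apply: cone_mismatch wx w0x.
rewrite ler_pdivrMr// => /le_trans; apply.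
rewrite [leRHS]mulrCA -mulrA ler_pM2l//.
apply: le_trans (ler_wpM2l _ geometric_bound); last exact: exprn_ge0.
rewrite mulrCA -exprMn mulrC (_ : 2 * (5 / 8) = 5 / 4 :> R)//; lra.
Qed.

End Directions.

(** * Counting the unlucky hard functions of a deterministic algorithm *)

Section Interaction.
Context {R : realType} {d K T : nat} {Z : Type} (i0 : 'I_d).
Hypothesis K_gt0 : (0 < K)%N.
Hypothesis d_gt1 : (1 < d)%N.
Variables (a : seq Z -> 'rV[R]_d) (O : oracle R d Z).
Hypothesis O_local : local_oracle O.
Implicit Types (s : T.-tuple 'I_K) (w : {ffun 'I_d -> bool}).

Definition query s w t := iterate a (O (hard i0 s (sgnvec i0 w))) t.

(** Queries are numbered from 0: query t is compared with the well of t + 1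
    letters, one more than the queries before it may have revealed. *)
Definition in_well s w t := well (take t.+1 s) (query s w t ord0 i0).

Definition in_cone s w t := 0 < cone i0 (sgnvec i0 w) (query s w t).

Definition unlucky s w t := in_well s w t || in_cone s w t.

Definition lucky_before s w t := [forall i : 'I_t, ~~ unlucky s w i].

Lemma near_not_well (u : seq 'I_K) (x : 'rV[R]_d) : ~~ well u (x ord0 i0) ->
  \forall y \near x, ~~ well u ((y : 'rV[R]_d) ord0 i0).
Proof.
rewrite /well -ltNge => xu; near=> y; rewrite -ltNge.
have : l2norm (y - x) < `|x ord0 i0 - bottom u| - rad R K ^+ size u.
  by near: y; apply: near_l2ball; lra.
have := coord_le (y - x) i0; rewrite !mxE distrC.
have := ler_normD (x ord0 i0 - y ord0 i0) (y ord0 i0 - bottom u).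
rewrite addrA subrK; lra.
Unshelve. all: by end_near. Qed.

(** Outside the well of a common prefix and both cones, the two functions
    agree with their bases, which in turn agree by the prefix property of the
    valleys. *)
Lemma hard_prefix s s' w w' t (x : 'rV[R]_d) : take t s = take t s' ->
  ~~ well (take t s) (x ord0 i0) ->
  cone i0 (sgnvec i0 w) x <= 0 -> cone i0 (sgnvec i0 w') x <= 0 ->
  \forall y \near x,
    hard i0 s (sgnvec i0 w) y = hard i0 s' (sgnvec i0 w') y.
Proof.
move=> ss' xs xw xw'.
have full (r : seq 'I_K) (z : R) : ~~ well (take t r) z -> ~~ well r z.
  by apply: contra; rewrite -{1}(cat_take_drop t r); exact: well_prefix.
have xs' : ~~ well (take t s') (x ord0 i0) by rewrite -ss'.
have n w1 : l2norm (sgnvec i0 w1) <= (1 : R) by rewrite l2norm_sgnvec.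
have h := hard_near_base (full _ _ xs) xw (n w).
have h' := hard_near_base (full _ _ xs') xw' (n w').
have v := near_not_well xs.
apply: (@filterS3 _ (nbhs x) _ _ _ _ _ _ h h' v) => y -> -> yv.
rewrite /base; congr (_ + _).
by rewrite -(cat_take_drop t s) -(cat_take_drop t s') -ss';
  exact: valley_prefix.
Qed.

(** As long as it is lucky, a run cannot see more than the letters already
    fixed: the local oracle gives the same answers for both functions. *)
Lemma responses_prefix s s' w w' t : take t s = take t s' ->
  lucky_before s w t -> lucky_before s' w' t -> query s w t = query s' w' t.
Proof.
move=> ss' sw sw'; congr (a _); move: ss' sw sw'.
elim: t => [//|t IHt] ss' /forallP sw /forallP sw' /=.
have tt : take t s = take t s'.
  by rewrite -(take_takel s (leqnSn t)) ss' take_takel.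
have eqr : responses a (O (hard i0 s (sgnvec i0 w))) t =
           responses a (O (hard i0 s' (sgnvec i0 w'))) t.
  apply: IHt => //; apply/forallP => i.
    exact: (sw (widen_ord (leqnSn t) i)).
  exact: (sw' (widen_ord (leqnSn t) i)).
have := sw ord_max; have := sw' ord_max.
rewrite /unlucky /in_well /in_cone /query /iterate /= -eqr !negb_or -!leNgt.
move=> /andP[_ xw'] /andP[xs xw]; congr rcons.
by apply: O_local; exact: hard_prefix ss' xs xw xw'.
Qed.

Definition upd s (t : 'I_T) (k : 'I_K) : T.-tuple 'I_K :=
  [tuple if i == t then k else tnth s i | i < T].

Lemma take_tuple_eq s s' t : (forall i : 'I_T, (i < t)%N ->
  tnth s i = tnth s' i) ->
  take t s = take t s'.
Proof.
move=> ss'; case: T s s' ss' => [|T'] s s' ss';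
  first by rewrite (tuple0 s) (tuple0 s').
have x0 := tnth s ord0.
apply: (@eq_from_nth _ x0); first by rewrite !size_take !size_tuple.
rewrite size_take size_tuple => i iT.
have [it iT'] : (i < t /\ i < T'.+1)%N by move: iT; case: ifP; lia.
by rewrite !nth_take//; have := ss' (Ordinal iT') it; rewrite !(tnth_nth x0).
Qed.

Lemma take_tuple_rcons s (t : 'I_T) : take t.+1 s = rcons (take t s) (tnth s t).
Proof. by rewrite (tnth_nth (tnth s t)) -take_nth ?size_tuple. Qed.

Definition first_well t :=
  [set p : T.-tuple 'I_K * {ffun 'I_d -> bool} |
    lucky_before p.1 p.2 t && in_well p.1 p.2 t]%SET.

Definition first_cone t :=
  [set p : T.-tuple 'I_K * {ffun 'I_d -> bool} |
    lucky_before p.1 p.2 t && in_cone p.1 p.2 t]%SET.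

(** Given the other letters and w, at most one value of the letter t makes
    query t the first failure, because that query is the same for all values
    while sibling wells are disjoint. Overwriting the letter t by an
    arbitrary k is therefore an injective map from pairs (k, failure). *)
Lemma card_first_well (t : 'I_T) :
  (K * #|first_well t| <= #|{: T.-tuple 'I_K * {ffun 'I_d -> bool}}|)%N.
Proof.
pose phi (q : 'I_K * (T.-tuple 'I_K * {ffun 'I_d -> bool})) :=
  (upd q.2.1 t q.1, q.2.2).
have injphi : {in finset.setX [set: 'I_K]%SET (first_well t) &, injective phi}.
  move=> [k [s w]] [k' [s' w']]; rewrite !inE /= => /andP[sw sW] /andP[sw' sW'].
  move=> phiE; have ww' : w = w' := congr1 snd phiE.
  have ss' i : tnth (upd s t k) i = tnth (upd s' t k') i.
    by have /= -> := congr1 fst phiE.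
  move: sw' sW'; rewrite -ww' => sw' sW'.
  have kk' : k = k' by have := ss' t; rewrite !tnth_mktuple eqxx.
  have off_t i : i != t -> tnth s i = tnth s' i.
    by move=> /negPf it; have := ss' i; rewrite !tnth_mktuple it.
  have tt : take t s = take t s'.
    by apply: take_tuple_eq => i it; apply: off_t; rewrite -val_eqE /= ltn_eqF.
  move: sW sW'; rewrite /in_well (responses_prefix tt sw sw')
    !take_tuple_rcons -tt => sW sW'.
  have st := well_disjoint K_gt0 sW sW'.
  rewrite kk'; congr (_, (_, _)); apply: eq_from_tnth => i.
  by have [->|/off_t] := eqVneq i t.
rewrite -[K in (K * _)%N]card_ord -cardsT -cardsX -(card_in_imset injphi).
exact: max_card.
Qed.

(** For a fixed word, query t does not depend on w among the runs that were
    lucky before, so the count is that of the cones through one point. *)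
Lemma card_first_cone (t : 'I_T) : #|first_cone t|%:R <=
  #|{: T.-tuple 'I_K}|%:R * (2 ^+ d * (2 * (15 / 16) ^+ d)) :> R.
Proof.
have -> : #|first_cone t| = (\sum_s #|[set w | (s, w) \in first_cone t]%SET|)%N.
  rewrite -sum1_card; under [RHS]eq_bigr => s _ do rewrite -sum1_card.
  rewrite pair_big_dep /=; apply: eq_bigl => -[s w] /=.
  by rewrite [in RHS]inE.
rewrite natr_sum -sumr_const mulr_suml; apply: ler_sum => s _; rewrite mul1r.
have [/eqP ->|/set0Pn[w0]] :=
  boolP ([set w | (s, w) \in first_cone t]%SET == finset.set0).
  by rewrite cards0 !mulr_ge0// exprn_ge0//; lra.
rewrite !inE /= => /andP[sw0 _].
apply: le_trans _ (card_cone i0 d_gt1 (query s w0 t)).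
rewrite ler_nat; apply: subset_leq_card; apply/fintype.subsetP => w.
rewrite !inE /= => /andP[sw]; rewrite /in_cone.
by rewrite (responses_prefix (erefl (take t s)) sw sw0).
Qed.

(** Sort the unlucky functions by the time of their first failure; with K >=
    2 ^ d letters the failures of either kind have density at most a constant
    times (15/16) ^ d. *)
Lemma card_unlucky : (2 ^ d <= K)%N ->
  #|[set p : T.-tuple 'I_K * {ffun 'I_d -> bool} |
     [exists t : 'I_T, unlucky p.1 p.2 t]]%SET|%:R <=
  #|{: T.-tuple 'I_K * {ffun 'I_d -> bool}}|%:R *
    (3 * T%:R * (15 / 16) ^+ d) :> R.
Proof.
move=> dK; set B := [set _ | _]%SET.
have cover : B \subset (\bigcup_(t : 'I_T) (first_well t :|: first_cone t))%SET.
  apply/fintype.subsetP => -[s w]; rewrite inE /= => /existsP[t0 t0u].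
  have [t tu tmin] := @arg_minnP _ t0 (fun t : 'I_T => unlucky s w t) val t0u.
  apply/bigcupP; exists t => //; rewrite !inE /= -andb_orr; apply/andP; split;
    last exact: tu.
  apply/forallP => i; apply/negP => iu.
  have := tmin (widen_ord (ltnW (ltn_ord t)) i) iu; rewrite /= leqNgt ltn_ord//.
have d0 : 0 <= (15 / 16) ^+ d :> R by apply: exprn_ge0; lra.
have each (t : 'I_T) : #|(first_well t :|: first_cone t)%SET|%:R <=
    #|{: T.-tuple 'I_K * {ffun 'I_d -> bool}}|%:R * (3 * (15 / 16) ^+ d) :> R.
  apply: (@le_trans _ _ (#|first_well t|%:R + #|first_cone t|%:R)).
    by rewrite -natrD ler_nat cardsU leq_subr.
  have -> : 3 * (15 / 16) ^+ d = (15 / 16) ^+ d + 2 * (15 / 16) ^+ d :> R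
    by ring.
  rewrite mulrDr lerD//; last first.
    apply: le_trans (card_first_cone t) _.
    by rewrite card_prod card_ffun card_bool card_ord natrM natrX mulrA.
  have := card_first_well t; rewrite -(ler_nat R) natrM.
  have : 2 ^+ d <= K%:R :> R by rewrite -natrX ler_nat.
  have half : 1 <= 2 ^+ d * (15 / 16) ^+ d :> R.
    by rewrite -exprMn exprn_ege1//; lra.
  set n : R := #|_|%:R; set k : R := K%:R; set N : R := #|_|%:R.
  set q := (2 ^+ d : R) in half *.
  set e := (_ ^+ d : R) in d0 half *.
  have n0 : 0 <= n by rewrite ler0n.
  move=> qk kn; have : q * n <= N by rewrite (le_trans _ kn)// ler_wpM2r.
  move=> qn; have : q * n * e <= N * e by rewrite ler_wpM2r.
  have : n * 1 <= n * (q * e) by rewrite ler_wpM2l.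
  lra.
apply: (@le_trans _ _ (\sum_(t < T) #|(first_well t :|: first_cone t)%SET|%:R)).
  rewrite -natr_sum ler_nat; apply: leq_trans (subset_leq_card cover) _.
  elim/big_ind2: _ => [|m A n A' mA nA'|//]; first by rewrite cards0.
  by rewrite (leq_trans (leq_card_setU _ _))// leq_add.
apply: le_trans (ler_sum _ (fun t _ => each t)) _.
rewrite sumr_const card_ord -[leLHS]mulr_natr le_eqVlt; apply/orP; left;
  apply/eqP; ring.
Qed.

End Interaction.

(** * Averaging over the seed and conclusion *)

Lemma exists_le_average (R : realType) (I : finType) (p : I -> R) (M : R) :
  (0 < #|I|)%N -> \sum_i p i <= #|I|%:R * M -> exists i, p i <= M.
Proof.
move=> I0 pM; apply: contrapT => /forallNP np.
suff : \sum_(i : I) M < \sum_i p i by rewrite sumr_const -mulr_natl ltNge pM.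
apply: ltr_sum => [|i _]; last by rewrite ltNge; exact/negP.
by have /card_gt0P[i _] := I0; apply/hasP; exists i; rewrite // mem_index_enum.
Qed.

(** For each outcome few indices are bad, so by exchanging the sum and the
    integral the average over the indices of the probabilities P (B i) is
    small, and some index does not exceed the average. *)
Lemma exists_unlikely (R : realType) (disp : measure_display)
    (Omega : measurableType disp) (P : probability Omega R) (I : finType)
    (B : I -> set Omega) (bad : Omega -> {set I}) (M : R) :
  (0 < #|I|)%N -> (forall i, measurable (B i)) ->
  (forall i w, B i w -> i \in bad w) ->
  (forall w, #|bad w|%:R <= #|I|%:R * M) ->
  exists i, (P (B i) <= M%:E)%E.
Proof.
move=> I0 mB Bbad badM.
have Pfin i : P (B i) \is a fin_num by rewrite fin_num_measure.
suff : \sum_i fine (P (B i)) <= #|I|%:R * M.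
  move=> /(exists_le_average I0)[i Pi]; exists i.
  by rewrite -(fineK (Pfin i)) lee_fin.
rewrite -lee_fin -sumEFin; under eq_bigr do rewrite fineK//.
under eq_bigr do rewrite -(setIT (B _)) -integral_indic//.
rewrite -ge0_integral_sum//; last first.
- by move=> i; apply/measurable_EFinP; exact: measurable_indic.
rewrite -[leRHS]mule1 -(@probability_setT _ _ _ P) -integral_cst//.
apply: ge0_le_integral => //.
- by move=> w _; apply: sume_ge0 => i _; rewrite lee_fin.
- by apply: emeasurable_sum => i; apply/measurable_EFinP;
  exact: measurable_indic.
move=> w _; rewrite sumEFin lee_fin (le_trans _ (badM w))//.
rewrite -sum1_card natr_sum [leRHS]big_mkcond /=; apply: ler_sum => i _.
rewrite indicE; case: (boolP (w \in B i)) => [/set_mem/Bbad -> //|_].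
by case: ifP.
Qed.

Lemma closed_far (R : realType) (d : nat) (S : set 'rV[R]_d) (c : R) :
  closed [set y | forall x, S x -> c <= l2norm (y - x)].
Proof.
have -> : [set y | forall x, S x -> c <= l2norm (y - x)] =
    \bigcap_(x in S) ((fun y => l2norm (y - x)) @^-1` [set r | c <= r]) by [].
apply: closed_bigI => x _; apply: preimage_closed; last exact: closed_ge.
by move=> y _; exact: l2dist_continuous.
Qed.

Lemma far_queriesE (R : realType) (d T : nat) (S : set 'rV[R]_d) (c : R)
    (q : nat -> 'rV[R]_d) :
  (c%:E <= ereal_inf [set \big[mine/+oo]_(t < T) (l2norm (q t - x))%:E | x in
    S])%E <->
  forall t : 'I_T, forall x, S x -> c <= l2norm (q t - x).
Proof.
split=> [cS t x Sx|cS].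
  have := le_trans cS (ereal_inf_lbound (imageP _ Sx)).
  by move=> /bigmin_geP[_ /(_ t isT)]; rewrite lee_fin.
apply: le_ereal_inf_tmp => _ [x Sx <-]; apply/bigmin_geP; split=> [|t _];
  first exact: leey.
by rewrite lee_fin cS.
Qed.

(** The event says that all queries are in the set of points at distance at
    least c from the stationary set, which is closed as an intersection of
    closed sets, hence Borel. *)
Lemma measurable_far_queries (R : realType) (d T : nat) (Z : Type)
    (disp : measure_display) (Omega : measurableType disp)
    (A : random_algorithm R d Z Omega) (O : oracle R d Z) (k c : R) f :
  iterates_measurable A O -> l2_lipschitz k f ->
  measurable [set w | (c%:E <= ereal_inf
    [set \big[mine/+oo]_(t < T) (l2norm (iterate (A w) (O f) t - x))%:E
      | x in stationary c f])%E].
Proof.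
move=> mA fk.
pose far := [set y : 'rV[R]_d | forall x, stationary c f x ->
  c <= l2norm (y - x)].
have -> : [set w | (c%:E <= ereal_inf
    [set \big[mine/+oo]_(t < T) (l2norm (iterate (A w) (O f) t - x))%:E
      | x in stationary c f])%E] =
    \bigcap_(t in [set t : 'I_T | True]) ((fun w => iterate (A w) (O f) t)
      @^-1` far).
  apply/seteqP; split => w /=.
    by move=> /far_queriesE h t _ x; exact: h.
  by move=> h; apply/far_queriesE => t x; exact: h.
apply: fin_bigcap_measurable => [|t _]; first exact: finite_finset.
have mfar : measurable (~` far : set (g_sigma_algebraType (@open 'rV[R]_d))).
  by apply: sub_sigma_algebra; apply: closed_openC; exact: closed_far.
have := mA k f fk t measurableT _ (measurableC mfar).
by rewrite setTI setCK.
Qed.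

(** The value of the function is nonnegative at a lucky query and -1 at a
    stationary point; the Lipschitz constant 65 converts this gap into a
    distance. *)
Lemma lucky_far (R : realType) (d K T : nat) (Z : Type) (i0 : 'I_d) (K_gt0 :
  (0 < K)%N)
    (d_gt1 : (1 < d)%N) (a : seq Z -> 'rV[R]_d) (O : oracle R d Z)
    (s : T.-tuple 'I_K) w (t : 'I_T) x c :
  ~~ unlucky i0 a O s w t -> c <= 1 / 65 ->
  stationary c (hard i0 s (sgnvec i0 w)) x ->
  c <= l2norm (query i0 a O s w t - x).
Proof.
rewrite /unlucky negb_or -leNgt => /andP[tw tc] c65.
move=> /(stationary_hard K_gt0 (sgnvec_axis _ _) (l2norm_sgnvec i0 d_gt1 _)) fx.
have {}fx : hard i0 s (sgnvec i0 w) x = -1 by apply: fx; lra.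
have f0 : 0 <= hard i0 s (sgnvec i0 w) (query i0 a O s w t).
  rewrite hard_channel_le0 ?base_ge0// ltW// channel_lt0//.
  by apply: contra tw; rewrite -{1}(cat_take_drop t.+1 s); exact: well_prefix.
have n1 : l2norm (sgnvec i0 w) <= (1 : R) by rewrite l2norm_sgnvec.
have := hard_lipschitz i0 K_gt0 s n1 (query i0 a O s w t) x.
rewrite fx ger0_norm; lra.
Qed.

Lemma expR_bound (R : realType) d : (15 / 16) ^+ d <=
  expR (- (1 / 100 * d%:R)) :> R.
Proof.
rewrite -mulNr expRM_natr; apply: lerXn2r; rewrite ?nnegrE ?expR_ge0//.
by apply: le_trans (expR_ge1Dx _); lra.
Qed.

Theorem theorem1 (R : realType) :
  exists c C : R, [/\ 0 < c, 0 < C &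
  forall (T d : nat) (Z : Type) (O : oracle R d Z)
    (disp : measure_display) (Omega : measurableType disp)
    (P : probability Omega R) (A : random_algorithm R d Z Omega),
    (2 <= d)%N -> local_oracle O -> iterates_measurable A O ->
  exists f : 'rV[R]_d -> R,
    [/\ l2_lipschitz C f,
        ((f 0)%:E - ereal_inf [set (f x)%:E | x in [set: 'rV[R]_d]]
           <= C%:E)%E,
        (ereal_inf [set (l2norm x)%:E | x in
            [set x : 'rV[R]_d | clarke f x = [set (0 : 'rV[R]_d)%R]]]
           <= C%:E)%E
      & ((1 - C * T%:R * expR (- (c * d%:R)))%:E <=
         P [set w |
             (c%:E <= ereal_inf
                [set \big[mine/+oo]_(t < T)
                       (l2norm (iterate (A w) (O f) t - x))%:E
                | x in stationary c f])%E])%E]].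
Proof.
exists (1 / 100), 100; split; [lra|lra|].
move=> T d Z O disp Omega P A d_gt1 O_local mA.
pose i0 : 'I_d := Ordinal (ltnW d_gt1).
pose K := (2 ^ d)%N; have K_gt0 : (0 < K)%N by rewrite expn_gt0.
pose I := (T.-tuple 'I_K * {ffun 'I_d -> bool})%type.
pose f (p : I) : 'rV[R]_d -> R := hard i0 p.1 (sgnvec i0 p.2).
have n1 w : l2norm (sgnvec i0 w) = (1 : R) by rewrite l2norm_sgnvec.
have flip p : l2_lipschitz 65 (f p) by apply: hard_lipschitz => //; rewrite n1.
pose good p := [set w | ((1 / 100)%:E <= ereal_inf
  [set \big[mine/+oo]_(t < T) (l2norm (iterate (A w) (O (f p)) t - x))%:E
    | x in stationary (1 / 100) (f p)])%E].
have mgood p : measurable (good p) by exact: measurable_far_queries mA (flip p).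
pose bad w := [set p : I | [exists t : 'I_T, unlucky i0 (A w) O p.1 p.2 t]]%SET.
have I0 : (0 < #|{: I}|)%N.
  by rewrite card_prod card_tuple card_ord card_ffun card_bool muln_gt0
    !expn_gt0.
have [p Pp] : exists p, (P (~` good p) <= (3 * T%:R * (15 / 16) ^+ d)%:E)%E.
  apply: (@exists_unlikely _ _ _ _ _ _ bad) => //.
  - by move=> p; exact: measurableC.
  - move=> p w; rewrite inE; apply: contra_notT => /existsPn lucky.
    apply/far_queriesE => t x; apply: (lucky_far K_gt0 d_gt1 (lucky t)); lra.
  - by move=> w; apply: card_unlucky.
have /= := hard_flat K_gt0 p.1 (sgnvec_axis i0 p.2) (n1 p.2) (lexx 3).
set x := (_ + _) => -[flat flat4].
exists (f p); split.
- move=> y z; apply: le_trans (flip p y z) _.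
  by have := l2norm_ge0 (y - z); lra.
- have f0 : f p 0 <= 1.
    rewrite ge_max; apply/andP; split; first lra.
    rewrite ge_min; apply/orP; left; rewrite /base mxE.
    rewrite [off i0 0](_ : _ = 0) ?l2norm0 ?addr0; last first.
      by apply/rowP => i; rewrite !mxE; case: ifP.
    by apply: valley_le1 => //; rewrite normr0.
  have inf_ge : ((-1)%:E <= ereal_inf [set (f p x)%:E | x in [set:
    'rV[R]_d]])%E.
    by apply: le_ereal_inf_tmp => _ [y _ <-]; rewrite lee_fin le_max lexx.
  apply: le_trans (leeB (lexx _) inf_ge) _.
  by rewrite -EFinB lee_fin; lra.
- apply: (@le_trans _ _ (l2norm x)%:E); last by rewrite lee_fin; lra.
  by apply: ereal_inf_lbound; exists x => //; exact: near_cst_clarke flat.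
- rewrite -[X in P X]/(good p) -(setCK (good p)) probability_setC;
  last exact: measurableC.
  rewrite EFinB; apply: leeB => //; apply: le_trans Pp _.
  rewrite lee_fin; apply: ler_pM; rewrite ?mulr_ge0 ?exprn_ge0//; try lra.
    by rewrite ler_wpM2r//; lra.
  exact: expR_bound.
Qed.
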